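(* Let $k$ be a positive integer and let $\varphi$ be a graded modal formula of modal depth at most $k$ in a modal vocabulary $\sigma$. The following are equivalent: (1) $\varphi$ is preserved under homomorphisms between finite pointed Kripke structures; (2) $\varphi$ is logically equivalent over finite pointed Kripke structures to an existential positive modal formula of modal depth at most $k$.
   Context: A modal vocabulary is a relational vocabulary all of whose symbols have arity at most 2; its structures are Kripke structures, and a pointed Kripke structure is $(\mathcal{A},a)$ with $a\in\mathcal{A}$; it is finite if $\mathcal{A}$ is finite. Unary symbols give propositional variables, binary symbols $R$ give modalities $\Diamond_R,\Box_R$ with accessibility relation $R^{\mathcal{A}}$. Graded modal formulas may also use $\Diamond_R^n,\Box_R^n$ ($n\ge0$), with $\mathcal{A},a\models\Diamond_R^n\psi$ iff at least $n$ $R$-successors of $a$ satisfy $\psi$, and $\Box_R^n=\neg\Diamond_R^n\neg$. Modal depth is the maximum nesting of modalities. An existential positive modal formula is a modal formula using only $\vee,\wedge$ and diamonds $\Diamond_R$. A homomorphism $(\mathcal{A},a)\to(\mathcal{B},b)$ is a $\sigma$-homomorphism sending $a$ to $b$; preservation means truth at the source point implies truth at the target point. *)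

(* Defs.v *)
From mathcomp Require Import all_boot.
Set Implicit Arguments.
Unset Strict Implicit.
Unset Printing Implicit Defensive.

(* The symbols of a modal vocabulary (relation symbols of arity 1 or 2), sorted
   by arity.  The vocabulary may be infinite. *)
Record modal_vocabulary : Type := ModalVocabulary {
  unary_symbol : Type;
  binary_symbol : Type
}.

Record finite_kripke (sigma : modal_vocabulary) : Type := FiniteKripke {
  world :> finType;
  valuation : unary_symbol sigma -> pred world;
  accessible : binary_symbol sigma -> rel world
}.

Inductive graded_formula (sigma : modal_vocabulary) : Type :=
| Var of unary_symbol sigma
| Top
| Bot
| Not of graded_formula sigma
| And of graded_formula sigma & graded_formula sigma
| Or of graded_formula sigma & graded_formula sigma
| Dia of binary_symbol sigma & graded_formula sigma
| Box of binary_symbol sigma & graded_formula sigma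
| GDia of nat & binary_symbol sigma & graded_formula sigma
| GBox of nat & binary_symbol sigma & graded_formula sigma.

Arguments Top {sigma}.
Arguments Bot {sigma}.

Fixpoint satisfies (sigma : modal_vocabulary) (A : finite_kripke sigma) (a : A)
    (phi : graded_formula sigma) : bool :=
  match phi with
  | Var p => valuation p a
  | Top => true
  | Bot => false
  | Not psi => ~~ satisfies a psi
  | And psi chi => satisfies a psi && satisfies a chi
  | Or psi chi => satisfies a psi || satisfies a chi
  | Dia r psi => [exists b : A, accessible r a b && satisfies b psi]
  | Box r psi => [forall b : A, accessible r a b ==> satisfies b psi]
  | GDia n r psi => n <= #|[set b : A | accessible r a b && satisfies b psi]|
  | GBox n r psi =>
      ~~ (n <= #|[set b : A | accessible r a b && ~~ satisfies b psi]|)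
  end.

Fixpoint modal_depth (sigma : modal_vocabulary) (phi : graded_formula sigma) :
    nat :=
  match phi with
  | Var _ | Top | Bot => 0
  | Not psi => modal_depth psi
  | And psi chi | Or psi chi => maxn (modal_depth psi) (modal_depth chi)
  | Dia _ psi | Box _ psi | GDia _ _ psi | GBox _ _ psi => (modal_depth psi).+1
  end.

(* Top and Bot are the empty conjunction and the empty disjunction.  Without
   Bot an unsatisfiable formula would have no existential positive equivalent:
   the one-point structure in which all relations are full satisfies every
   formula built from variables, conjunction, disjunction and diamonds. *)
Fixpoint existential_positive (sigma : modal_vocabulary)
    (phi : graded_formula sigma) : bool :=
  match phi with
  | Var _ | Top | Bot => true
  | And psi chi | Or psi chi =>
      existential_positive psi && existential_positive chi
  | Dia _ psi => existential_positive psi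
  | Not _ | Box _ _ | GDia _ _ _ | GBox _ _ _ => false
  end.

Definition homomorphism (sigma : modal_vocabulary) (A B : finite_kripke sigma)
    (h : A -> B) : Prop :=
  (forall (p : unary_symbol sigma) (x : A), valuation p x -> valuation p (h x))
  /\ (forall (r : binary_symbol sigma) (x y : A),
        accessible r x y -> accessible r (h x) (h y)).

Definition preserved_under_homomorphisms (sigma : modal_vocabulary)
    (phi : graded_formula sigma) : Prop :=
  forall (A B : finite_kripke sigma) (a : A) (b : B) (h : A -> B),
    homomorphism h -> h a = b -> satisfies a phi -> satisfies b phi.

Definition equivalent_over_finite (sigma : modal_vocabulary)
    (phi psi : graded_formula sigma) : Prop :=
  forall (A : finite_kripke sigma) (a : A), satisfies a phi = satisfies a psi.

(* Main.v *)
Require Import Defs.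
From mathcomp Require Import all_boot.
From mathcomp Require Import boolp.
From Stdlib Require List.

(** A depth-[k] type records the variables true at a point and, recursively,
    the depth-[k-1] types of its successors; over finitely many symbols there
    are finitely many types, each described by an existential positive formula
    of depth at most [k].  If [b] satisfies the formula of the type of [a], then
    [a] is [k]-step simulated by [b].  Pairing every point reached from [a] with
    one chosen simulating point gives a finite structure in which the pair
    [(a, b)] satisfies the same graded formulas of depth at most [k] as [a],
    and whose projection to the second component is a homomorphism.  Hence a
    preserved [phi] true at [a] is true at [b], and [phi] is equivalent to the
    disjunction of the types that imply it. *)

Set Implicit Arguments.
Unset Strict Implicit.
Unset Printing Implicit Defensive.

(** * Preservation of existential positive formulas *)

Lemma existential_positive_preserved (sigma : modal_vocabulary)
    (psi : graded_formula sigma) :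
  existential_positive psi -> preserved_under_homomorphisms psi.
Proof.
move=> + A B a b h [hv hr].
elim: psi a b => //=.
- by move=> p a b _ <-; apply: hv.
- move=> psi IHpsi chi IHchi a b /andP[/IHpsi Hpsi /IHchi Hchi] hab.
  by case/andP=> /(Hpsi _ _ hab)-> /(Hchi _ _ hab)->.
- move=> psi IHpsi chi IHchi a b /andP[/IHpsi Hpsi /IHchi Hchi] hab.
  by case/orP=> [/(Hpsi _ _ hab)->|/(Hchi _ _ hab)->]; rewrite ?orbT.
- move=> r psi IH a b /IH Hpsi <- /existsP[c /andP[ac cpsi]].
  by apply/existsP; exists (h c); rewrite hr ?(Hpsi c).
Qed.

(** The vocabulary may be infinite; types built only from the symbols occurring in a formula are
    finite in number. *)
Fixpoint unary_symbols (sigma : modal_vocabulary)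
    (phi : graded_formula sigma) : seq (unary_symbol sigma) :=
  match phi with
  | Var p => [:: p]
  | Top | Bot => [::]
  | And psi chi | Or psi chi => unary_symbols psi ++ unary_symbols chi
  | Not psi | Dia _ psi | Box _ psi | GDia _ _ psi | GBox _ _ psi =>
      unary_symbols psi
  end.

Fixpoint binary_symbols (sigma : modal_vocabulary)
    (phi : graded_formula sigma) : seq (binary_symbol sigma) :=
  match phi with
  | Var _ | Top | Bot => [::]
  | Not psi => binary_symbols psi
  | And psi chi | Or psi chi => binary_symbols psi ++ binary_symbols chi
  | Dia r psi | Box r psi | GDia _ r psi | GBox _ r psi =>
      r :: binary_symbols psi
  end.

Lemma In_tnth (T : Type) (s : seq T) (x : T) :
  List.In x s -> exists i, tnth (in_tuple s) i = x.
Proof.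
elim: s => //= y s IH [<-|/IH[i <-]]; first by exists ord0.
by exists (lift ord0 i); rewrite !(tnth_nth x).
Qed.

Lemma exists_card (T : finType) (P : pred T) :
  [exists x, P x] = (0 < #|[set x | P x]|).
Proof.
by rewrite card_gt0; apply/existsP/set0Pn => -[x]; exists x; rewrite ?inE in p *.
Qed.

(** * Types and the formulas describing them *)

Section Types.

Variables (sigma : modal_vocabulary) (I J : finType).
Variables (ps : I -> unary_symbol sigma) (rs : J -> binary_symbol sigma).

Fixpoint modal_type (n : nat) : finType :=
  if n is m.+1 then ({set I} * {set J * modal_type m})%type else {set I}.

Definition atoms_formula (P : {set I}) : graded_formula sigma :=
  \big[@And sigma/Top]_(i in P) Var (ps i).

Fixpoint type_formula (n : nat) : modal_type n -> graded_formula sigma :=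
  if n is m.+1 then
    fun t : modal_type m.+1 =>
      And (atoms_formula t.1)
        (\big[@And sigma/Top]_(d in t.2) Dia (rs d.1) (type_formula d.2))
  else fun t : modal_type 0 => atoms_formula t.

Definition atoms_of (A : finite_kripke sigma) (a : A) : {set I} :=
  [set i | valuation (ps i) a].

Fixpoint type_of (n : nat) (A : finite_kripke sigma) (a : A) : modal_type n :=
  if n is m.+1 then
    (atoms_of a, [set d : J * modal_type m |
       [exists c : A, accessible (rs d.1) a c && (type_of m c == d.2)]])
  else atoms_of a.

Lemma satisfies_bigAnd (A : finite_kripke sigma) (a : A) (T : finType)
    (P : pred T) (F : T -> graded_formula sigma) :
  satisfies a (\big[@And sigma/Top]_(x | P x) F x)
  = [forall (x | P x), satisfies a (F x)].
Proof. by rewrite -big_andE; apply: big_morph. Qed.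

Lemma satisfies_bigOr (A : finite_kripke sigma) (a : A) (T : finType)
    (P : pred T) (F : T -> graded_formula sigma) :
  satisfies a (\big[@Or sigma/Bot]_(x | P x) F x)
  = [exists (x | P x), satisfies a (F x)].
Proof. by rewrite -big_orE; apply: big_morph. Qed.

Lemma satisfies_atoms (A B : finite_kripke sigma) (a : A) (b : B) :
  satisfies b (atoms_formula (atoms_of a))
  = [forall i, valuation (ps i) a ==> valuation (ps i) b].
Proof.
by rewrite satisfies_bigAnd; apply: eq_forallb => i; rewrite inE.
Qed.

Lemma type_formula_EP (n : nat) (t : modal_type n) :
  existential_positive (type_formula t).
Proof.
have EPand (T : finType) (P : pred T) (F : T -> graded_formula sigma) :
    (forall x, existential_positive (F x)) ->
    existential_positive (\big[@And sigma/Top]_(x | P x) F x).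
  by move=> EPF; elim/big_ind: _ => //= x y -> ->.
by elim: n t => [|n IH] t /=; rewrite !EPand //= => d; apply: IH.
Qed.

Lemma type_formula_depth (n : nat) (t : modal_type n) :
  modal_depth (type_formula t) <= n.
Proof.
have depth_and m (T : finType) (P : pred T) (F : T -> graded_formula sigma) :
    (forall x, modal_depth (F x) <= m) ->
    modal_depth (\big[@And sigma/Top]_(x | P x) F x) <= m.
  by move=> leF; elim/big_ind: _ => //= x y lex ley; rewrite geq_max lex.
elim: n t => [|n IH] t /=; first exact: depth_and.
by rewrite geq_max !depth_and // => d; apply: IH.
Qed.

(** * Bounded simulation *)

Definition simulated (n : nat) (A B : finite_kripke sigma) (a : A) (b : B) :=
  satisfies b (type_formula (type_of n a)).

Lemma simulated_refl (n : nat) (A : finite_kripke sigma) (a : A) :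
  simulated n a a.
Proof.
rewrite /simulated; elim: n a => [|n IH] a /=; rewrite satisfies_atoms.
  by apply/forallP => i; apply/implyP.
apply/andP; split; first by apply/forallP => i; apply/implyP.
rewrite satisfies_bigAnd; apply/forall_inP => d; rewrite inE.
case/existsP=> c /andP[ac /eqP<-]; apply/existsP; exists c.
by rewrite ac; apply: IH.
Qed.

Lemma simulated_valuation (n : nat) (A B : finite_kripke sigma) (a : A) (b : B)
    (i : I) :
  simulated n a b -> valuation (ps i) a -> valuation (ps i) b.
Proof.
have: simulated n a b -> satisfies b (atoms_formula (atoms_of a)).
  by case: n => [//|n] /andP[].
by rewrite satisfies_atoms => /[apply] /forallP/(_ i)/implyP.
Qed.

Lemma simulated_step (n : nat) (A B : finite_kripke sigma) (a c : A) (b : B)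
    (j : J) :
  simulated n.+1 a b -> accessible (rs j) a c ->
  exists d : B, accessible (rs j) b d && simulated n c d.
Proof.
rewrite /simulated /= => /andP[_]; rewrite satisfies_bigAnd => /forall_inP sim ac.
(* As [c] is a successor of [a], its type is one of those recorded in the type of [a], so [b]
   satisfies the corresponding diamond. *)
apply/existsP/(sim (j, type_of n c)).
by rewrite inE; apply/existsP; exists c; rewrite ac /=.
Qed.

(** * The companion structure *)

Section Companion.

Variables (k : nat) (A B : finite_kripke sigma).

(** The default [b] is never taken when [r] is some [rs j] and [c] is an [r]-successor of a point
    that [b] simulates for [n.+1] steps. *)
Definition simulating_successor (r : binary_symbol sigma) (n : nat) (c : A)
    (b : B) : B :=
  odflt b [pick d : B | accessible r b d && simulated n c d].

(* The first component counts the remaining simulation steps. *)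
Definition companion : finite_kripke sigma :=
  @FiniteKripke sigma ('I_k.+1 * A * B)%type
    (fun p x => valuation p x.1.2 && valuation p x.2)
    (fun r x y => [&& x.1.1 == y.1.1.+1 :> nat,
       accessible r x.1.2 y.1.2, accessible r x.2 y.2
       & y.2 == simulating_successor r y.1.1 y.1.2 x.2]).

Lemma companion_snd_hom : homomorphism (fun x : companion => x.2).
Proof. by split=> [p x /andP[]|r x y /and4P[]]. Qed.

(* The chosen successor makes the successors of a companion point correspond
   bijectively to those of its first component, so that they are counted
   alike. *)
Lemma companion_card (n : 'I_k.+1) (a : A) (b : B) (j : J)
    (P : pred companion) (Q : pred A) :
  0 < n -> simulated n a b ->
  (forall (m : 'I_k.+1) (c : A) (d : B),
     m.+1 = n -> simulated m c d -> P (m, c, d) = Q c) ->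
  #|[set y : companion | accessible (rs j) ((n, a, b) : companion) y && P y]|
  = #|[set c : A | accessible (rs j) a c && Q c]|.
Proof.
case: n => -[//|n] ltn _ sim PQ.
pose m : 'I_k.+1 := Ordinal (ltnW ltn).
pose f c : companion := (m, c, simulating_successor (rs j) n c b).
have succP c : accessible (rs j) a c ->
    accessible (rs j) b (f c).2 && simulated n c (f c).2.
  move=> /(simulated_step sim)[d dP]; rewrite /f /simulating_successor /=.
  by case: pickP => [//|/(_ d)]; rewrite dP.
have f_inj : injective f by move=> c d [].
rewrite -(card_imset _ f_inj); apply: eq_card => y; rewrite inE.
apply/andP/imsetP => [[]|[c]].
  (* Surjectivity: the counter clause forces [m' = m], and the choice clause forces [d] to be the
     chosen successor. *)
  case: y => [[m' c] d] /and4P[/= /eqP[em] ac bd /eqP ed] Py.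
  have {}em : m' = m by apply: val_inj.
  rewrite {m'}em in ed Py *; exists c; last by rewrite ed.
  have /andP[_ simc] := succP c ac.
  by rewrite inE ac -(PQ m c d) // ed.
rewrite inE => /andP[ac Qc ->]; have /andP[bd simc] := succP c ac.
by rewrite /= eqxx ac bd eqxx PQ.
Qed.

(** Simulation makes the valuation conjunct from [B] redundant. Each modality uses one step of the
    counter, and equal successor counts settle diamonds and boxes alike. *)
Lemma companion_satisfies (psi : graded_formula sigma) :
  (forall p, List.In p (unary_symbols psi) -> exists i, ps i = p) ->
  (forall r, List.In r (binary_symbols psi) -> exists j, rs j = r) ->
  forall (n : 'I_k.+1) (a : A) (b : B),
  modal_depth psi <= n -> simulated n a b ->
  satisfies ((n, a, b) : companion) psi = satisfies a psi.
Proof.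
(* Diamonds count successors satisfying [psi0] ([g] is [id]), boxes those refuting it ([g] is
   [negb]). *)
have card_succ r psi0 :
    (forall (n : 'I_k.+1) (a : A) (b : B), modal_depth psi0 <= n ->
       simulated n a b ->
       satisfies ((n, a, b) : companion) psi0 = satisfies a psi0) ->
    (exists j, rs j = r) ->
    forall (g : bool -> bool) (n : 'I_k.+1) (a : A) (b : B),
    modal_depth psi0 < n -> simulated n a b ->
    #|[set y : companion | accessible r ((n, a, b) : companion) y
                           && g (satisfies y psi0)]|
    = #|[set c : A | accessible r a c && g (satisfies c psi0)]|.
  move=> IH [j <-] g n a b lt_n sim.
  apply: (@companion_card n a b j (fun y => g (satisfies y psi0))
                          (fun c => g (satisfies c psi0))) => //.
    exact: leq_trans lt_n.
  by move=> m c d em simc; rewrite IH // -ltnS em.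
elim: psi => //=.
- move=> p /(_ p (or_introl erefl))[i <-] _ n a b _ sim.
  by apply/andb_idr/(simulated_valuation sim).
- by move=> psi IH Hp Hr n a b le_n sim; rewrite IH.
- move=> psi IH chi IH' Hp Hr n a b; rewrite geq_max => /andP[le1 le2] sim.
  by rewrite IH ?IH' // => x Hx; (apply: Hp || apply: Hr);
     apply/List.in_app_iff; (by left) || right.
- move=> psi IH chi IH' Hp Hr n a b; rewrite geq_max => /andP[le1 le2] sim.
  by rewrite IH ?IH' // => x Hx; (apply: Hp || apply: Hr);
     apply/List.in_app_iff; (by left) || right.
- move=> r psi IH Hp Hr n a b lt_n sim; rewrite !exists_card.
  rewrite (card_succ r psi _ _ id) //; last by apply: Hr; left.
  by apply: IH => // s Hs; apply: Hr; right.
- move=> r psi IH Hp Hr n a b lt_n sim.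
  (* A box fails exactly when the set of refuting successors is nonempty. *)
  apply: negb_inj; rewrite !negb_forall.
  under eq_existsb do rewrite negb_imply.
  under [RHS]eq_existsb do rewrite negb_imply.
  rewrite !exists_card (card_succ r psi _ _ negb) //; last by apply: Hr; left.
  by apply: IH => // s Hs; apply: Hr; right.
- move=> q r psi IH Hp Hr n a b lt_n sim.
  rewrite (card_succ r psi _ _ id) //; last by apply: Hr; left.
  by apply: IH => // s Hs; apply: Hr; right.
- move=> q r psi IH Hp Hr n a b lt_n sim.
  rewrite (card_succ r psi _ _ negb) //; last by apply: Hr; left.
  by apply: IH => // s Hs; apply: Hr; right.
Qed.

End Companion.

End Types.

(** * From simulation to the equivalence *)

Lemma preserved_under_simulation (k : nat) (sigma : modal_vocabulary)
    (I J : finType) (ps : I -> unary_symbol sigma)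
    (rs : J -> binary_symbol sigma) (phi : graded_formula sigma)
    (A B : finite_kripke sigma) (a : A) (b : B) :
  (forall p, List.In p (unary_symbols phi) -> exists i, ps i = p) ->
  (forall r, List.In r (binary_symbols phi) -> exists j, rs j = r) ->
  modal_depth phi <= k -> preserved_under_homomorphisms phi ->
  simulated ps rs k a b -> satisfies a phi -> satisfies b phi.
Proof.
move=> Hp Hr le_k pres sim aphi.
pose x : companion ps rs k A B := (ord_max, a, b).
apply: (pres _ _ x b _ (companion_snd_hom ps rs k A B)) => //.
by rewrite (companion_satisfies Hp Hr).
Qed.

Theorem theorem4p23 (k : nat) (sigma : modal_vocabulary)
    (phi : graded_formula sigma) (hk : 0 < k) (hphi : modal_depth phi <= k) :
  preserved_under_homomorphisms phi <->
  exists psi : graded_formula sigma,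
    [/\ existential_positive psi, modal_depth psi <= k
      & equivalent_over_finite phi psi].
Proof.
split=> [pres|[psi [EPpsi _ eqv]] A B a b h hom hab]; last first.
  by rewrite !eqv; apply: existential_positive_preserved hab.
(* Positions in the symbol lists serve as finite index types, so symbols need no decidable equality;
   repetitions are harmless. *)
pose ps := tnth (in_tuple (unary_symbols phi)).
pose rs := tnth (in_tuple (binary_symbols phi)).
pose implies_phi (t : modal_type _ _ k) :=
  forall (B : finite_kripke sigma) (b : B),
    satisfies b (type_formula ps rs t) -> satisfies b phi.
exists (\big[@Or sigma/Bot]_(t | `[< implies_phi t >]) type_formula ps rs t).
split.
- by elim/big_ind: _ => [|x y /= -> ->|t _] //; apply: type_formula_EP.
- elim/big_ind: _ => [|x y /= lex ley|t _] //; first by rewrite geq_max lex.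
  exact: type_formula_depth.
- move=> A a; rewrite satisfies_bigOr.
  apply/idP/exists_inP => [aphi|[t /asboolP]]; last exact.
  (* The disjunct true at [a] is its own type, which implies [phi] because [phi] holds at [a] and
     passes to every simulating point. *)
  exists (type_of ps rs k a); last exact: simulated_refl.
  apply/asboolP => B b sim.
  exact: (preserved_under_simulation (@In_tnth _ _) (@In_tnth _ _)) sim aphi.
Qed.
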